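(* Let $m$ be a positive integer, let $s,t$ be units of $\mathbb{Z}_m=\mathbb{Z}/m\mathbb{Z}$ with $(1-s)(1-t)=0$ in $\mathbb{Z}_m$, and let $X=\mathbb{Z}_{m;s,t}$ be the associated Alexander biquandle. For $n\ge 2$, the map $\theta_n\in C^n_{NYB}(X;\mathbb{Z}_m)$ defined by $$\theta_n(x_1,\ldots,x_n)=\prod_{i=1}^{n-1}(x_i-x_{i+1})$$ and extended linearly to all elements of $C_n^{NYB}(X)$ is an $n$-cocycle; that is, $\theta_n$ is a well-defined homomorphism $C_n^{NYB}(X)\to\mathbb{Z}_m$ and $\theta_n\circ\partial_{n+1}^{NYB}=0$.
   Context: The Alexander biquandle $\mathbb{Z}_{m;s,t}$ is the set $X=\mathbb{Z}_m$ with the set-theoretic Yang-Baxter operator $R=(R_1,R_2):X\times X\to X\times X$, $R(a,b)=((1-s)a+sb,\ ta+(1-t)b)$. For $n>0$, $C_n^{YB}(X)$ is the free abelian group generated by $X^n$, with boundary $\partial_n^{YB}=\sum_{i=1}^n(-1)^{i+1}(d_{i,n}^l-d_{i,n}^r)$, where the face maps $d^l_{i,n},d^r_{i,n}:C_n^{YB}(X)\to C_{n-1}^{YB}(X)$ are the linear extensions of the following maps $X^n\to X^{n-1}$: $d^l_{i,n}$ applies $R$ successively to the coordinates in positions $(i-1,i),(i-2,i-1),\ldots,(1,2)$ and then deletes the first coordinate (so $d^l_{1,n}$ just deletes the first coordinate); $d^r_{i,n}$ applies $R$ successively to the coordinates in positions $(i,i+1),(i+1,i+2),\ldots,(n-1,n)$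 and then deletes the last coordinate (so $d^r_{n,n}$ just deletes the last coordinate). For $n\ge2$, $C_n^D(X)\subset C_n^{YB}(X)$ is the subgroup spanned by the tuples $(x_1,\ldots,x_n)$ such that $R(x_i,x_{i+1})=(x_i,x_{i+1})$ for some $1\le i\le n-1$; $C_n^D(X)=0$ for $n<2$. This is a subcomplex. The normalized complex is $C_n^{NYB}(X)=C_n^{YB}(X)/C_n^D(X)$ with induced boundary $\partial_n^{NYB}$. For an abelian group $A$, $C^n_{NYB}(X;A)=\mathrm{Hom}(C_n^{NYB}(X),A)$ with coboundary $\delta^n_{NYB}=\mathrm{Hom}(\partial^{NYB},\mathrm{Id}_A)$, i.e. precomposition with $\partial_{n+1}^{NYB}$; an $n$-cocycle is an element of $C^n_{NYB}(X;A)$ annihilated by the coboundary. *)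

(* Defs.v *)
From HB Require Import structures.
From mathcomp Require Import all_boot all_algebra.
From mathcomp Require Import generic_quotient ring_quotient.
From mathcomp Require Import boolp.
From mathcomp Require Import freeg.
From mathcomp Require Import zify ring.

Set Implicit Arguments.
Unset Strict Implicit.
Unset Printing Implicit Defensive.

Import GRing.Theory.
Local Open Scope ring_scope.
Local Open Scope quotient_scope.

(* Z/mZ for every m > 0. The type 'Z_m of zmodp is Z/2Z when m = 1, and 'I_1
   carries no ring structure there; Zmod 1 is the zero ring, hence only a
   pzRingType. As GRing.unit requires a nonzero ring, invertibility is stated
   by is_unit. *)
Definition Zmod (m : nat) := 'I_m.-1.+1.

HB.instance Definition _ m := GRing.Zmodule.on (Zmod m).
HB.instance Definition _ m := Finite.on (Zmod m).
HB.instance Definition _ m :=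
  GRing.Zmodule_isComPzRing.Build (Zmod m)
    (@Zp_mulA m.-1.+1) (@Zp_mulC m.-1.+1) (@Zp_mul1z m.-1) (@Zp_mul_addl m.-1.+1).

Definition is_unit (A : comPzRingType) (u : A) : Prop := exists v : A, u * v = 1.

Section Alexander.
Variable A : comPzRingType.

Definition alexander (s t : A) (p : A * A) : A * A :=
  ((1 - s) * p.1 + s * p.2, t * p.1 + (1 - t) * p.2).

End Alexander.

Section Action.
Local Open Scope nat_scope.
Variables (X : eqType) (R : X * X -> X * X).
Implicit Types (x : seq X) (k : nat) (s : seq nat).

(* R applied to the entries of x of (0-based) indices k and k.+1. *)
Fixpoint act k x : seq X :=
  match k, x with
  | 0, a :: b :: x' => (R (a, b)).1 :: (R (a, b)).2 :: x'
  | k'.+1, a :: x' => a :: act k' x'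
  | _, _ => x
  end.

Definition acts s x : seq X := foldl (fun y k => act k y) x s.

Definition degenerate x : bool := has (fun p => R p == p) (zip x (behead x)).

Definition yang_baxter : Prop :=
  forall x, size x = 3 -> acts [:: 0; 1; 0] x = acts [:: 1; 0; 1] x.

(* Faces, with 0-based index i: d^l_{i+1,n} and d^r_{i+1,n}, n = size x. *)
Definition face_l_seq i x : seq X := behead (acts (rev (iota 0 i)) x).
Definition face_r_seq i x : seq X :=
  take (size x).-1 (acts (iota i ((size x).-1 - i)) x).

Lemma size_act k x : size (act k x) = size x.
Proof. by elim: k x => [[|a [|b x]]|k IH [|a x]] //=; rewrite IH. Qed.

Lemma size_acts s x : size (acts s x) = size x.
Proof. by elim: s x => //= k s IH x; rewrite IH size_act. Qed.

Lemma size_face_l n i (x : n.+1.-tuple X) : size (face_l_seq i x) == n.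
Proof. by rewrite size_behead size_acts size_tuple. Qed.

Lemma size_face_r n i (x : n.+1.-tuple X) : size (face_r_seq i x) == n.
Proof. by rewrite size_take size_acts size_tuple /= ltnSn. Qed.

Definition face_l n (i : 'I_n.+1) (x : n.+1.-tuple X) : n.-tuple X :=
  Tuple (size_face_l i x).
Definition face_r n (i : 'I_n.+1) (x : n.+1.-tuple X) : n.-tuple X :=
  Tuple (size_face_r i x).

Definition fixed_at k x := k.+1 < size x /\ act k x = x.

Lemma degenerateP x : reflect (exists k, fixed_at k x) (degenerate x).
Proof.
rewrite /degenerate; elim: x => [|a [|b x] IH] /=.
- by apply: ReflectF => -[k [] ].
- by apply: ReflectF => -[k [] ].
apply: (iffP orP) => [[/eqP h|/IH [k [h1 h2]]]|[[|k] [/= h1 h2]]].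
- by exists 0%N; split=> //=; rewrite h.
- by exists k.+1; split=> //=; rewrite h2.
- by left; apply/eqP; move: h2; case: (R (a, b)) => c d [-> ->].
- by right; apply/IH; exists k; split=> //; case: h2.
Qed.

Lemma act_far k l x : k.+1 < l -> act k (act l x) = act l (act k x).
Proof.
elim: k l x => [|k IH] [|l] [|a x] //= h; last by rewrite IH.
by case: l h => // l _; case: x => [|b x].
Qed.

Lemma acts_far k s x : all (fun l => (k.+1 < l) || (l.+1 < k)) s ->
  act k (acts s x) = acts s (act k x).
Proof.
elim: s x => //= l s IH x /andP[h1 h2]; rewrite IH //.
by case/orP: h1 => h; first rewrite (act_far _ h); rewrite ?(act_far _ h).
Qed.

Lemma acts_cat s1 s2 x : acts (s1 ++ s2) x = acts s2 (acts s1 x).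
Proof. by rewrite /acts foldl_cat. Qed.

Lemma act_braid k x : yang_baxter -> k.+2 < size x ->
  act k (act k.+1 (act k x)) = act k.+1 (act k (act k.+1 x)).
Proof.
move=> yb; elim: k x => [|k IH] [|a x] //=; last by move=> h; rewrite IH.
case: x => [|b [|c x]] // _.
by case: (yb [:: a; b; c] erefl) => /= -> -> ->.
Qed.

Lemma fixed_acts_far k s x : all (fun l => (k.+1 < l) || (l.+1 < k)) s ->
  fixed_at k x -> fixed_at k (acts s x).
Proof. by move=> h [h1 h2]; split; rewrite ?size_acts // acts_far // h2. Qed.

Lemma fixed_up k x : yang_baxter -> k.+2 < size x ->
  fixed_at k x -> fixed_at k.+1 (act k (act k.+1 x)).
Proof.
move=> yb h [h1 h2]; split; first by rewrite !size_act.
by rewrite -act_braid // h2.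
Qed.

Lemma fixed_down k x : yang_baxter ->
  fixed_at k.+1 x -> fixed_at k (act k.+1 (act k x)).
Proof.
move=> yb [h1 h2]; split; first by rewrite !size_act ltnW.
by rewrite act_braid // h2.
Qed.

Lemma fixed_behead k x : fixed_at k.+1 x -> degenerate (behead x).
Proof.
case: x => [[]|a x [/= h1 [h2]]] //.
by apply/degenerateP; exists k.
Qed.

Lemma act_take k n x : k.+1 < n -> act k (take n x) = take n (act k x).
Proof.
elim: k n x => [|k IH] [|n] [|a x] //=; last by move=> h; rewrite IH.
by case: n x => // n [|b x].
Qed.

Lemma fixed_take k n x : k.+1 < n -> fixed_at k x -> degenerate (take n x).
Proof.
move=> h [h1 h2]; apply/degenerateP; exists k; split.
  by rewrite size_take; case: ifP.
by rewrite act_take // h2.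
Qed.

Lemma face_l_seq_degenerate k i x : yang_baxter -> fixed_at k x ->
  i < size x -> i != k -> i != k.+1 -> degenerate (face_l_seq i x).
Proof.
move=> yb fx ix nik nik1; rewrite /face_l_seq.
have [ik|ki] := ltnP i k.
  case: k fx nik nik1 ik => // k fx _ _ ik; apply: (@fixed_behead k).
  apply: fixed_acts_far fx; apply/allP => l.
  by rewrite mem_rev mem_iota; lia.
apply: (@fixed_behead k).
have -> : i = (k + (2 + (i - k.+2)))%N by lia.
rewrite !iotaD !rev_cat !acts_cat /= add0n.
apply: fixed_acts_far; first by apply/allP => l; rewrite mem_rev mem_iota; lia.
apply: fixed_up => //; first by rewrite size_acts; lia.
by apply: fixed_acts_far fx; apply/allP => l; rewrite mem_rev mem_iota; lia.
Qed.

Lemma face_r_seq_degenerate k i x : yang_baxter -> fixed_at k x ->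
  i < size x -> i != k -> i != k.+1 -> degenerate (face_r_seq i x).
Proof.
move=> yb fx ix nik nik1; have kx := fx.1; rewrite /face_r_seq.
have [ki|ik] := ltnP k i.
  apply: (@fixed_take k); first lia.
  by apply: fixed_acts_far fx; apply/allP => l; rewrite mem_iota; lia.
case: k fx nik nik1 kx ik => [|k] fx nik nik1 kx ik; first lia.
apply: (@fixed_take k); first lia.
have -> : ((size x).-1 - i = (k - i) + (2 + ((size x).-1 - k.+2)))%N by lia.
rewrite !iotaD !acts_cat (_ : (i + (k - i) = k)%N) /=; last lia.
apply: fixed_acts_far; first by apply/allP => l; rewrite mem_iota; lia.
apply: fixed_down => //.
by apply: fixed_acts_far fx; apply/allP => l; rewrite mem_iota; lia.
Qed.

Lemma face_l_seq_eq k x : fixed_at k x -> face_l_seq k.+1 x = face_l_seq k x.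
Proof.
move=> [_ h]; rewrite /face_l_seq -addn1 iotaD rev_cat acts_cat /=.
by rewrite add0n h.
Qed.

Lemma face_r_seq_eq k x : fixed_at k x -> face_r_seq k.+1 x = face_r_seq k x.
Proof.
move=> [h1 h]; rewrite /face_r_seq.
have -> : ((size x).-1 - k = ((size x).-1 - k.+1).+1)%N by lia.
by rewrite /= h.
Qed.

End Action.

Section Span.
Variables (K : choiceType) (P : pred K).

Definition spanned : {pred {freeg K / int}} := fun c =>
  `[< exists a : seq (int * K),
        all (fun p => P p.2) a /\ c = \sum_(p <- a) p.1 *: << p.2 >> >].

Lemma spanned_zmod_closed : zmod_closed spanned.
Proof.
split=> [|_ _ /asboolP[a [Pa ->]] /asboolP[b [Pb ->]]].
  by apply/asboolP; exists [::]; rewrite big_nil.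
apply/asboolP; exists (a ++ [seq (- p.1, p.2) | p <- b]); split.
  by rewrite all_cat Pa all_map.
rewrite big_cat big_map -sumrN; congr (_ + _).
by apply: eq_bigr => p _; rewrite scaleNr.
Qed.

HB.instance Definition _ :=
  GRing.isZmodClosed.Build {freeg K / int} spanned spanned_zmod_closed.

Lemma spanned_gen k : P k -> << k >> \in spanned.
Proof.
move=> Pk; apply/asboolP; exists [:: (1, k)]; rewrite /= Pk; split=> //.
by rewrite big_seq1 scale1r.
Qed.

End Span.

Section Complex.
Variables (X : choiceType) (R : X * X -> X * X).

(* For n = 0 this is free on the empty tuple, a convention that plays no role
   in degrees n >= 1. *)
Definition CYB (n : nat) := {freeg (n.-tuple X) / int}.

Definition boundaryYB_gen n (x : n.+1.-tuple X) : CYB n :=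
  \sum_(i < n.+1) (-1) ^+ i *: (<< face_l R i x >> - << face_r R i x >>).

Definition boundaryYB n : CYB n.+1 -> CYB n := fglift (@boundaryYB_gen n).

HB.instance Definition _ n :=
  GRing.isZmodMorphism.Build (CYB n.+1) (CYB n) (@boundaryYB n)
    (lift_is_additive (@boundaryYB_gen n)).

(* C_n^D is 0 for n < 2, as no such tuple is degenerate. *)
Definition CD n : {pred CYB n} := spanned (fun x : n.-tuple X => degenerate R x).

HB.instance Definition _ n :=
  GRing.ZmodClosed.copy (@CD n) (spanned (fun x : n.-tuple X => degenerate R x)).

Definition CNYB n := @Quotient.quot (CYB n) (@CD n).

Definition classNYB n (c : CYB n) : CNYB n := \pi_(CNYB n) c.

(* The class of the boundary of a representative, independent of its choice by
   boundaryNYB_class when R satisfies the Yang-Baxter equation. *)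
Definition boundaryNYB n (c : CNYB n.+1) : CNYB n :=
  classNYB (boundaryYB (repr c)).

Lemma boundaryYB_degenerate n (c : CYB n.+1) : yang_baxter R ->
  c \in @CD n.+1 -> boundaryYB c \in @CD n.
Proof.
move=> yb /asboolP[a [Pa ->]]; rewrite raddf_sum big_seq.
apply: rpred_sum => -[z x] /(allP Pa)/= /degenerateP[k fx].
rewrite -[z]intz scaler_int raddfMz rpredMz //= /boundaryYB liftU scale1r.
have [h _] := fx; rewrite size_tuple in h.
have h' := ltnW h.
rewrite /boundaryYB_gen (bigD1 (Ordinal h')) //= (bigD1 (Ordinal h)) /=; last first.
  by rewrite -val_eqE /=; lia.
rewrite addrA rpredD //.
  have -> : face_l R (Ordinal h) x = face_l R (Ordinal h') x.
    by apply: val_inj; apply: face_l_seq_eq.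
  have -> : face_r R (Ordinal h) x = face_r R (Ordinal h') x.
    by apply: val_inj; apply: face_r_seq_eq.
  by rewrite exprS mulN1r scaleNr subrr rpred0.
apply: rpred_sum => i /andP[]; rewrite -!val_eqE /= => ik ik1.
have deg: << face_l R i x >> - << face_r R i x >> \in @CD n.
  have ix : (i < size x)%N by rewrite size_tuple.
  apply: rpredB; apply: spanned_gen.
    exact: face_l_seq_degenerate fx ix ik ik1.
  exact: face_r_seq_degenerate fx ix ik ik1.
by rewrite -[_ ^+ _]intz scaler_int rpredMz.
Qed.

Lemma boundaryNYB_class n (c : CYB n.+1) : yang_baxter R ->
  boundaryNYB (classNYB c) = classNYB (boundaryYB c).
Proof.
move=> yb; rewrite /boundaryNYB /classNYB.
apply/eqP; rewrite -Quotient.idealrBE -raddfB.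
apply: boundaryYB_degenerate => //.
by rewrite Quotient.idealrBE reprK.
Qed.

Definition cochainNYB n (A : zmodType) := {additive CNYB n -> A}.

Definition coboundaryNYB n (A : zmodType) (f : cochainNYB n A) : CNYB n.+1 -> A :=
  f \o @boundaryNYB n.

Definition cocycleNYB n (A : zmodType) (f : cochainNYB n A) : Prop :=
  coboundaryNYB f =1 fun=> 0.

End Complex.

Lemma alexander_yang_baxter (A : comPzRingType) (s t : A) :
  (1 - s) * (1 - t) = 0 -> yang_baxter (alexander s t).
Proof.
move=> st [|a [|b [|c []]]] //= _; rewrite /alexander /=.
have eqB (u v w : A) : u = v + (1 - s) * (1 - t) * w -> u = v.
  by rewrite st mul0r addr0.
congr [:: _; _; _].
- by apply: (eqB _ _ (s * (b - a))); ring.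
- by apply: (eqB _ _ (t * a + (1 - t) * b - ((1 - s) * b + s * c))); ring.
- by apply: (eqB _ _ (t * (c - b))); ring.
Qed.

(* Main.v *)
From HB Require Import structures.
Require Import Defs.
From mathcomp Require Import all_boot all_algebra.
From mathcomp Require Import generic_quotient ring_quotient.
From mathcomp Require Import boolp.
From mathcomp Require Import freeg.
From mathcomp Require Import ring.

Set Implicit Arguments.
Unset Strict Implicit.
Unset Printing Implicit Defensive.

Import GRing.Theory.
Local Open Scope ring_scope.

(** The coboundary of theta vanishes for the left and the right faces
    separately.

    Write u_i for the difference of the consecutive entries x_i and x_{i+1} of
    a tuple x_0, ..., x_n, so that theta is the product of the differences. Let
    an entry move leftwards (or rightwards) through the tuple by successive
    applications of R. Since (1 - s)(1 - t) = 0, the value of the moving entry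
    is forgotten by the differences of the entries it has passed: those
    differences are just multiplied by t (resp. by s). Only where the entry was
    taken out does a new difference appear, t u_{i-1} + u_i (resp.
    u_{i-1} + s u_i). With P_i the product of all u_j for j <> i, where
    0 <= i < n, and with P_{-1} = P_n = 0, this gives
    theta (d^l_i x) = t^(i-1) P_{i-1} + t^i P_i, and
    theta (d^r_i x) = s^(n-i) P_{i-1} + s^(n-1-i) P_i, and in both cases the
    alternating sum over i telescopes to 0.

    The telescoping is carried out by induction on the tuple: prefixing an entry
    a to b :: c :: x multiplies the alternating sum by - t (a - b), resp. by
    - (a - b) (diff_prod_face_l_sum, diff_prod_face_r_sum).

    As s is a unit, R fixes a pair (a, b) only if a = b, so theta vanishes on
    degenerate tuples and descends to the normalized complex. *)

(** * Alternating sums and products of consecutive differences *)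

Section Sums.
Variable A : comPzRingType.

Definition alt_sum (f : nat -> A) (n : nat) : A :=
  \sum_(0 <= i < n) (-1) ^+ i * f i.

Lemma alt_sumS (f : nat -> A) n :
  alt_sum f n.+1 = f 0%N - alt_sum (fun i => f i.+1) n.
Proof.
rewrite /alt_sum big_nat_recl // expr0 mul1r -sumrN; congr (_ + _).
by apply: eq_bigr => i _; rewrite exprS mulN1r mulNr.
Qed.

Lemma eq_alt_sum (f g : nat -> A) n : f =1 g -> alt_sum f n = alt_sum g n.
Proof. by move=> fg; apply: eq_bigr => i _; rewrite fg. Qed.

Lemma alt_sumZ (c : A) (f : nat -> A) n :
  alt_sum (fun i => c * f i) n = c * alt_sum f n.
Proof. by rewrite /alt_sum mulr_sumr; apply: eq_bigr => i _; rewrite mulrCA. Qed.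

Definition diff_prod (x : seq A) : A :=
  \prod_(0 <= i < (size x).-1) (nth 0 x i - nth 0 x i.+1).

Lemma diff_prod1 (a : A) : diff_prod [:: a] = 1.
Proof. by rewrite /diff_prod big_geq. Qed.

Lemma diff_prod_cons (a b : A) x :
  diff_prod [:: a, b & x] = (a - b) * diff_prod (b :: x).
Proof. by rewrite /diff_prod /= big_nat_recl. Qed.

End Sums.

(** * Faces of an extended tuple *)

Section Faces.
Variables (X : eqType) (R : X * X -> X * X).

Lemma acts_succ l (a : X) x : acts R (map succn l) (a :: x) = a :: acts R l x.
Proof. by elim: l x => //= k l IH x; rewrite IH. Qed.

Lemma acts_leftS i (a : X) x :
  acts R (rev (iota 0 i.+1)) (a :: x) =
    act R 0 (a :: acts R (rev (iota 0 i)) x).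
Proof.
rewrite -[iota 0 i.+1]/(0%N :: iota 1 i) rev_cons -cats1 acts_cat.
by rewrite (iotaDl 1) -map_rev acts_succ.
Qed.

Lemma face_l_seq0 (a : X) x : face_l_seq R 0 (a :: x) = x.
Proof. by []. Qed.

Lemma face_l_seq1 (a b : X) x :
  face_l_seq R 1 [:: a, b & x] = (R (a, b)).2 :: x.
Proof. by []. Qed.

Lemma face_r_seqS i (a b : X) x :
  face_r_seq R i.+1 [:: a, b & x] = a :: face_r_seq R i (b :: x).
Proof. by rewrite /face_r_seq /= subSS (iotaDl 1) acts_succ. Qed.

Lemma face_r_seq0 (a b : X) x :
  face_r_seq R 0 [:: a, b & x] =
    (R (a, b)).1 :: face_r_seq R 0 ((R (a, b)).2 :: x).
Proof. by rewrite /face_r_seq /= !subn0 (iotaDl 1) acts_succ. Qed.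

End Faces.

(** * The cocycle identity on tuples *)

Section Alexander.
Variables (A : comPzRingType) (s t : A).
Hypothesis st0 : (1 - s) * (1 - t) = 0.
Local Notation R := (alexander s t).

(** Equality modulo the ideal of (1 - s)(1 - t), with the multiplier w as a
    certificate that reduces each use to a ring identity. *)
Let eq_mod_st (w u v : A) : u = v + (1 - s) * (1 - t) * w -> u = v.
Proof. by rewrite st0 mul0r addr0. Qed.

(** The entry moving leftwards has the values p, then (1 - s) b + s p, before it
    passes b and then a. By (1 - s)(1 - t) = 0 these two values contribute
    equally to what b and a become, hence cancel in the difference. *)
Lemma diff_prod_face_l i (a b c : A) x :
  diff_prod (face_l_seq R i.+2 [:: a, b, c & x]) =
    t * (a - b) * diff_prod (face_l_seq R i.+1 [:: b, c & x]).
Proof.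
rewrite /face_l_seq !acts_leftS.
have: size (acts R (rev (iota 0 i)) (c :: x)) = (size x).+1 by rewrite size_acts.
case: (acts _ _ _) => [|p z] //= _.
rewrite diff_prod_cons; congr (_ * _).
by apply: (@eq_mod_st (b - p)); rewrite /=; ring.
Qed.

Lemma diff_prod_face_l_sum (a b : A) x :
  alt_sum (fun i => diff_prod (face_l_seq R i [:: a, b & x])) (size x).+2 = 0.
Proof.
elim: x a b => [|c x IH] a b.
  by rewrite !alt_sumS /alt_sum big_geq // !diff_prod1 subr0 subrr.
(* The induction hypothesis gives the sum over the faces of b :: c :: x of index
   at least 1. *)
have := IH b c; rewrite alt_sumS => /subr0_eq IHb.
rewrite 2!alt_sumS (eq_alt_sum _ (fun i => diff_prod_face_l i a b c x)).
rewrite alt_sumZ -IHb !face_l_seq0 face_l_seq1 !diff_prod_cons /=.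
ring.
Qed.

(** The entry a that moves through b :: x leaves no trace in the differences of
    the entries it has passed. *)
Lemma diff_prod_face_r0 (a b : A) x :
  diff_prod (face_r_seq R 0 [:: a, b & x]) = s ^+ size x * diff_prod (b :: x).
Proof.
elim: x a b => [|c x IH] a b; first by rewrite !diff_prod1 mulr1.
have := IH (R (a, b)).2 c; rewrite 3!face_r_seq0 !diff_prod_cons => ->.
rewrite exprS /=.
by apply: (@eq_mod_st ((a - b) * (s ^+ size x * diff_prod (c :: x)))); ring.
Qed.

Lemma diff_prod_face_rS i (a b c : A) x :
  diff_prod (face_r_seq R i.+2 [:: a, b, c & x]) =
    (a - b) * diff_prod (face_r_seq R i.+1 [:: b, c & x]).
Proof. by rewrite !face_r_seqS diff_prod_cons. Qed.

(** Where b was taken out, its neighbours a and (1 - s) b + s c meet. *)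
Lemma diff_prod_face_r1 (a b c : A) x :
  diff_prod (face_r_seq R 1 [:: a, b, c & x]) =
    (a - b + s * (b - c)) * diff_prod (face_r_seq R 0 [:: b, c & x]).
Proof. by rewrite face_r_seqS face_r_seq0 diff_prod_cons /=; congr (_ * _); ring. Qed.

Lemma diff_prod_face_r_sum (a b : A) x :
  alt_sum (fun i => diff_prod (face_r_seq R i [:: a, b & x])) (size x).+2 = 0.
Proof.
elim: x a b => [|c x IH] a b.
  by rewrite !alt_sumS /alt_sum big_geq // !diff_prod1 subr0 subrr.
have := IH b c; rewrite alt_sumS => /subr0_eq IHb.
rewrite 2!alt_sumS (eq_alt_sum _ (fun i => diff_prod_face_rS i a b c x)).
rewrite alt_sumZ -IHb diff_prod_face_r1 !diff_prod_face_r0 diff_prod_cons exprS.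
ring.
Qed.

End Alexander.

Lemma diff_prod_degenerate (A : comPzRingType) (s t : A) (x : seq A) :
  is_unit s -> degenerate (alexander s t) x -> diff_prod x = 0.
Proof.
move=> [v sv]; elim: x => [|a [|b x] IH] //=.
rewrite diff_prod_cons => /orP[/eqP[Ra _]|/IH ->]; last by rewrite mulr0.
suff -> : a - b = 0 by rewrite mul0r.
have sab : s * (a - b) = a - ((1 - s) * a + s * b) by ring.
by rewrite -[a - b]mul1r -sv mulrAC sab Ra subrr mul0r.
Qed.

(** * Cochains of the normalized complex *)

Section Extension.
Variables (K : choiceType) (A : zmodType) (f : K -> A).

(** The extension operator of free groups takes its values in a module over the
    coefficient ring; here A is regarded as a module over the integers. *)
Definition lin_ext : {freeg K / int} -> A := fglift (f : K -> zmodule A).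

HB.instance Definition _ :=
  GRing.isZmodMorphism.Build {freeg K / int} A lin_ext
    (lift_is_additive (f : K -> zmodule A)).

Lemma lin_extZ (z : int) c : lin_ext (z *: c) = lin_ext c *~ z.
Proof. by rewrite -[z in LHS]intz scaler_int raddfMz. Qed.

Lemma lin_extU k : lin_ext << k >> = f k.
Proof. by rewrite /lin_ext liftU scale1r. Qed.

Lemma lin_ext_spanned (P : pred K) c :
  (forall k, P k -> f k = 0) -> c \in spanned P -> lin_ext c = 0.
Proof.
move=> f0 /asboolP[a [Pa ->]]; rewrite raddf_sum big_seq big1 // => -[z k] ka.
by rewrite /= lin_extZ lin_extU f0 ?mul0rz //; apply: (allP Pa _ ka).
Qed.

End Extension.

Section Normalized.
Variables (X : choiceType) (R : X * X -> X * X) (n : nat) (A : zmodType).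
Variable f : n.-tuple X -> A.

Definition norm_ext (c : CNYB R n) : A := lin_ext f (repr c).

Hypothesis f0 : forall x : n.-tuple X, degenerate R x -> f x = 0.

Lemma norm_extE (c : CYB X n) :
  norm_ext (classNYB R c) = lin_ext f c.
Proof.
apply/eqP; rewrite -subr_eq0 -raddfB; apply/eqP.
apply: (lin_ext_spanned f0).
by rewrite -/(@CD X R n) Quotient.idealrBE reprK.
Qed.

Lemma norm_ext_additive : zmod_morphism norm_ext.
Proof.
move=> c d; rewrite -[c]reprK -[d]reprK -raddfB.
by rewrite -!/(classNYB R _) !norm_extE raddfB.
Qed.

Definition norm_cochain : cochainNYB R n A :=
  HB.pack norm_ext
    (GRing.isZmodMorphism.Build (CNYB R n) A norm_ext norm_ext_additive).

Lemma norm_cochainU (x : n.-tuple X) : norm_cochain (classNYB R << x >>) = f x.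
Proof. by rewrite /= norm_extE lin_extU. Qed.

(** The value on a class can be computed on any representative (norm_extE), so
    the coboundary is a linear extension and is determined on generators. *)
Lemma norm_cochain_cocycle :
  (forall x : n.+1.-tuple X, lin_ext f (boundaryYB R << x >>) = 0) ->
  cocycleNYB norm_cochain.
Proof.
move=> fd c; rewrite /coboundaryNYB /= /boundaryNYB norm_extE.
elim/freeg_ind_dom0: (repr c) => [|z x D _ _ IH]; first by rewrite !raddf0.
rewrite -{1}[z]intz -freegU_mulz.
by rewrite !raddfD /= IH addr0 !raddfMz /= fd mul0rz.
Qed.

End Normalized.

Lemma diff_prod_boundary (A : comPzRingType) (s t : A) n (x : n.+1.-tuple A) :
  (1 - s) * (1 - t) = 0 -> (0 < n)%N ->
  lin_ext (fun y : n.-tuple A => diff_prod y)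
    (boundaryYB (alexander s t) << x >>) = 0.
Proof.
move=> st0 n_gt0; rewrite /boundaryYB liftU scale1r raddf_sum /=.
pose l i := diff_prod (face_l_seq (alexander s t) i x).
pose r i := diff_prod (face_r_seq (alexander s t) i x).
transitivity (alt_sum l n.+1 - alt_sum r n.+1).
  rewrite /alt_sum !big_mkord -sumrB; apply: eq_bigr => i _.
  rewrite lin_extZ raddfB /= !lin_extU -mulrBr -mulrzl.
  by rewrite rmorphXn rmorphN1.
rewrite /l /r; move: (size_tuple x).
case: (tval x) => [|a [|b y]] //= [sz]; rewrite -sz // in n_gt0 *.
by rewrite diff_prod_face_l_sum // diff_prod_face_r_sum // subrr.
Qed.

Theorem theorem2p5 (m n : nat) (s t : Zmod m) (hm : (0 < m)%N)
  (hs : is_unit s) (ht : is_unit t) (hst : (1 - s) * (1 - t) = 0)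
  (hn : (2 <= n)%N) :
  exists theta : cochainNYB (alexander s t) n (Zmod m),
    (forall x : n.-tuple (Zmod m),
       theta (classNYB (alexander s t) << x >>) =
         \prod_(0 <= i < n.-1) (nth 0 x i - nth 0 x i.+1)) /\
    cocycleNYB theta.
Proof.
have theta0 (x : n.-tuple (Zmod m)) :
    degenerate (alexander s t) x -> diff_prod x = 0.
  exact: diff_prod_degenerate hs.
exists (norm_cochain theta0); split=> [x|].
  by rewrite norm_cochainU /diff_prod size_tuple.
apply: norm_cochain_cocycle => x.
by apply: diff_prod_boundary hst _; apply: ltnW.
Qed.
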